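(* Let $A$ be an algebra and $X$ be a convergent (left-monomial) $1$-polygraph that is a presentation of $A$. Then the set $\mathrm{Red}_m(X)$ of reduced monomials is (through the canonical projection onto $A$) a linear basis of $A$. As a consequence, the vector space $\mathrm{Red}(X)$ of reduced $0$-cells, equipped with the product defined by $a\cdot b=\widehat{ab}$, is an algebra that is isomorphic to $A$.
   Context: Fix a field $\mathbb{K}$; algebras are unital associative $\mathbb{K}$-algebras. A $1$-polygraph $X=\langle X_0\,|\,X_1\rangle$ is a set $X_0$ and a set $X_1$ (of ''$1$-cells'') with two maps $s,t:X_1\to\mathcal{A}(X_0)$ into the free algebra on $X_0$. $I(X)$ is the two-sided ideal of $\mathcal{A}(X_0)$ generated by the boundaries $\partial(\alpha)=s(\alpha)-t(\alpha)$, $\alpha\in X_1$, and $\overline{X}=\mathcal{A}(X_0)/I(X)$ is the algebra presented by $X$; $X$ is a presentation of $A$ if $A\simeq\overline{X}$. Monomials are the elements of the free monoid $X_0^*$; they form a linear basis of $\mathcal{A}(X_0)$, and $\mathrm{supp}(a)$ is the set of monomials with nonzero coefficient in $a$. $X$ is left-monomial if, for each $\alpha\in X_1$, $s(\alpha)$ is a monomial not belonging to $\mathrm{supp}(t(\alpha))$. The free $1$-algebra $\mathcal{A}(X)$ has as $0$-cells the elements of $\mathcal{A}(X_0)$; its $1$-cells are the elements of the quotient of the $\mathcal{A}(X_0)$-bimodule $(\mathcal{A}(X_0)\otimes\mathbb{K}X_1\otimes\mathcal{A}(X_0))\oplus\mathcal{A}(X_0)$ by the sub-bimodule generated by the elements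 $(a s(b)+t(a)b-t(a)s(b))-(s(a)b+a t(b)-s(a)t(b))$ for $a,b$ in the first summand, where $s(a\alpha b)=a s(\alpha) b$, $t(a\alpha b)=a t(\alpha) b$, and an element $c$ of the second summand is the identity $1_c$, with source and target $c$. Composition of $f:a\to b$ and $g:b\to c$ is $f\star_0 g=f-1_b+g$. A $1$-monomial is a $1$-cell $u\alpha v$ with $u,v$ monomials and $\alpha\in X_1$. Let $X$ be left-monomial. A rewriting step is a $1$-cell $\lambda f+1_a$ with $f$ a $1$-monomial, $\lambda\in\mathbb{K}\setminus\{0\}$ and $a$ a $0$-cell with $s(f)\notin\mathrm{supp}(a)$. A positive $1$-cell is a (possibly empty) composite of rewriting steps. A $0$-cell is reduced if it is not the source of a rewriting step; reduced $0$-cells form the linear subspace $\mathrm{Red}(X)$ of $\mathcal{A}(X_0)$, and $\mathrm{Red}_m(X)$ is the set of reduced monomials. A normal form of $a$ is a reduced $0$-cell $b$ such that there is a positive $1$-cell $a\to b$. Let $\succ_X$ be the smallest transitive relation on $X_0^*$ that is stable by product ($u\succ u'$ implies $vuw\succ vu'w$) and such that $s(\alpha)\succ_X v$ for all $\alpha\in X_1$, $v\in\mathrm{supp}(t(\alpha))$; $X$ terminates if $\succ_X$ is wellfounded. $X$ is confluent if, for all positive $1$-cells $f,g$ with the same source, there are positive $1$-cells $h,k$ with $s(h)=t(f)$, $s(k)=t(g)$ and $t(h)=t(k)$. $X$ is convergent if it is terminating and confluent; then every $0$-cell $a$ has a unique normal form, denoted by $\widehat{a}$. *)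

(* Defs.v *)
From HB Require Import structures.
From mathcomp Require Import all_boot all_order all_algebra.
From mathcomp Require Import generic_quotient ring_quotient.
From mathcomp Require Import boolp finmap.
From mathcomp.multinomials Require Import monalg.

Set Implicit Arguments.
Unset Strict Implicit.
Unset Printing Implicit Defensive.

Import GRing.Theory.
Local Open Scope ring_scope.
Local Open Scope quotient_scope.

Local Notation "{ 'quot' I }" := (@Quotient.quot _ I) : type_scope.

(* algType only covers nontrivial rings, whereas the zero algebra is a
   legitimate unital associative algebra (it is presented by a convergent
   polygraph with a rule 1 => 0). *)
Record is_algebra (K : fieldType) (V : lmodType K) (one : V)
    (mul : V -> V -> V) : Prop := IsAlgebra {
  alg_mulA : associative mul;
  alg_mul1l : left_id one mul;
  alg_mul1r : right_id one mul;
  alg_linl : forall y, linear (fun x => mul x y);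
  alg_linr : forall x, linear (mul x) }.

Record algebra (K : fieldType) := Algebra {
  alg_space :> lmodType K;
  alg_one : alg_space;
  alg_mul : alg_space -> alg_space -> alg_space;
  algP : is_algebra alg_one alg_mul }.

Definition algebra_iso (K : fieldType) (A B : algebra K) (f : A -> B) : Prop :=
  [/\ linear f, f (alg_one A) = alg_one B,
      {morph f : x y / alg_mul x y >-> alg_mul x y} & bijective f].

Definition linear_basis (K : fieldType) (V : lmodType K) (I : choiceType)
    (P : I -> Prop) (b : I -> V) : Prop :=
  (forall (s : seq I) (c : I -> K), uniq s -> (forall i, i \in s -> P i) ->
     \sum_(i <- s) c i *: b i = 0 -> forall i, i \in s -> c i = 0) /\
  (forall v : V, exists (s : seq I) (c : I -> K),
     (forall i, i \in s -> P i) /\ v = \sum_(i <- s) c i *: b i).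

Fact congr_lin (K : fieldType) (V : lmodType K) (a : K) (x x' y y' : V) :
  x = x' -> y = y' -> a *: x + y = a *: x' + y'.
Proof. by move=> -> ->. Qed.

Section LmodQuotient.
Context {K : fieldType} {V : lmodType K} (I : submodClosed V).

Definition zmod_of_submod : {pred V} := I.

Fact zmod_of_submod_closed : zmod_closed zmod_of_submod.
Proof. exact: (submodClosedP I : zmod_closed _). Qed.

HB.instance Definition _ :=
  GRing.isZmodClosed.Build V zmod_of_submod zmod_of_submod_closed.

Definition lquot := {quot zmod_of_submod}.

HB.instance Definition _ := GRing.Zmodule.on lquot.

Definition lpi (x : V) : lquot := \pi_{quot zmod_of_submod} x.
Definition lrepr (q : lquot) : V := repr (q : {quot zmod_of_submod}).

Lemma lreprK : cancel lrepr lpi.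
Proof. by move=> q; rewrite /lpi /lrepr reprK. Qed.

Lemma lpiP (x y : V) : lpi x = lpi y <-> x - y \in I.
Proof. by have := Quotient.idealrBE zmod_of_submod x y => /= ->; split=> /eqP. Qed.

Lemma lpiB x y : lpi (x - y) = lpi x - lpi y.
Proof. by rewrite /lpi !piE. Qed.

HB.instance Definition _ := GRing.isZmodMorphism.Build V lquot lpi lpiB.

Definition lquot_scale (c : K) (q : lquot) : lquot := lpi (c *: lrepr q).

Lemma lquot_scaleE c x : lquot_scale c (lpi x) = lpi (c *: x).
Proof.
by apply/lpiP; rewrite -scalerBr; apply/rpredZ/lpiP; rewrite lreprK.
Qed.

Lemma lquot_scaleA a b v :
  lquot_scale a (lquot_scale b v) = lquot_scale (a * b) v.
Proof. by rewrite -[v]lreprK !lquot_scaleE scalerA. Qed.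

Lemma lquot_scale1 : left_id 1 lquot_scale.
Proof. by move=> v; rewrite -[v]lreprK lquot_scaleE scale1r. Qed.

Lemma lquot_scaleDr : right_distributive lquot_scale +%R.
Proof.
move=> a u v; rewrite -[u]lreprK -[v]lreprK.
by rewrite -raddfD !lquot_scaleE -raddfD scalerDr.
Qed.

Lemma lquot_scaleDl v : {morph lquot_scale^~ v : a b / a + b}.
Proof. by move=> a b; rewrite -[v]lreprK !lquot_scaleE -raddfD scalerDl. Qed.

HB.instance Definition _ := GRing.Zmodule_isLmodule.Build K lquot
  lquot_scaleA lquot_scale1 lquot_scaleDr lquot_scaleDl.

Lemma lpi_is_scalable : scalable lpi.
Proof. by move=> c x; rewrite -lquot_scaleE. Qed.

HB.instance Definition _ :=
  GRing.isScalable.Build K V lquot *:%R lpi lpi_is_scalable.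

End LmodQuotient.

(* Locked, here and below, because conversion otherwise unfolds finite maps. *)
HB.lock Definition lin_ext (K : fieldType) (B : choiceType) (V : lmodType K)
    (f : B -> V) (x : {malg K[B]}) : V :=
  \sum_(k <- msupp x) x@_k *: f k.

Section LinearExtension.
Context {K : fieldType} {B : choiceType} {V : lmodType K}.
Implicit Type f : B -> V.

Lemma lin_extEw f x (d : {fset B}) : (msupp x `<=` d)%fset ->
  lin_ext f x = \sum_(k <- d) x@_k *: f k.
Proof.
move=> le; rewrite lin_ext.unlock (big_fset_incl _ le) // => k _ kx.
by rewrite mcoeff_outdom // scale0r.
Qed.

Lemma lin_ext_is_linear f : linear (lin_ext f).
Proof.
move=> a x y; pose d := (msupp x `|` msupp y `|` msupp (a *: x + y))%fset.
have lx : (msupp x `<=` d)%fset by rewrite /d -fsetUA fsubsetUl.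
have ly : (msupp y `<=` d)%fset by rewrite /d fsetUAC fsubsetUr.
have lz : (msupp (a *: x + y) `<=` d)%fset by rewrite /d fsubsetUr.
rewrite (lin_extEw _ lx) (lin_extEw _ ly) (lin_extEw _ lz) scaler_sumr -big_split.
by apply: eq_bigr => k _; rewrite mcoeffD mcoeffZ scalerDl scalerA.
Qed.

HB.instance Definition _ f :=
  GRing.isLinear.Build K {malg K[B]} V *:%R (lin_ext f) (lin_ext_is_linear f).

Lemma lin_ext0 f : lin_ext f 0 = 0. Proof. exact: linear0. Qed.

Lemma lin_extP f a x y : lin_ext f (a *: x + y) = a *: lin_ext f x + lin_ext f y.
Proof. exact: linearP. Qed.

Lemma lin_extU f k : lin_ext f << k >> = f k.
Proof. by rewrite lin_ext.unlock msuppU oner_eq0 big_seq_fset1 mcoeffUU scale1r. Qed.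

Lemma malg_lin_ind (P : {malg K[B]} -> Prop) :
    P 0 -> (forall a k x, P x -> P (a *: << k >> + x)) -> forall x, P x.
Proof.
move=> P0 PD x; rewrite [x]monalgE.
rewrite (eq_bigr (fun k => x@_k *: << k >>)); last first.
  by move=> k _; apply/malgP=> l; rewrite mcoeffZ !mcoeffU mulrnAr mulr1.
elim: (enum_fset (msupp x)) => [|k s IH]; first by rewrite big_nil.
rewrite big_cons; exact: PD.
Qed.

End LinearExtension.

Section FreeAlgebra.
Context {K : fieldType} {T : choiceType}.
Implicit Types x y : {malg K[{fmonom T}]}.

Lemma malg_scalerAr (c : K) x y : c *: (x * y) = x * (c *: y).
Proof.
rewrite -[c *: y]mul_malgC mulrA; have -> : x * c%:MP = c *: x.
  rewrite malgM_def malgZ_def fgmulgU.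
  by apply: eq_bigr => k _; rewrite mulm1 mulrC.
by rewrite scalerAl.
Qed.

Lemma malg_mulUU (u v : {fmonom T}) :
  << u >> * << v >> = << mmul u v >> :> {malg K[{fmonom T}]}.
Proof. by rewrite malgM_def fgmulUU mulr1. Qed.

End FreeAlgebra.

(* The monomial m, as an element of the free algebra, is << m >>. *)
Notation monomial T := {fmonom T}.
Notation free_algebra K T := {malg K[{fmonom T}]}.

(* The monomials u alpha v form a linear basis of the free bimodule
   A(T) (x) K G (x) A(T), which is thus encoded as the vector space on such
   triples. *)
Notation free_bimodule K T G := {malg K[(monomial T * G * monomial T)%type]}.

HB.lock Definition bimod_l (K : fieldType) (T G : choiceType)
    (a : free_algebra K T) (x : free_bimodule K T G) : free_bimodule K T G :=
  lin_ext (fun w => lin_ext (fun k =>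
    << (mmul w k.1.1, k.1.2, k.2) >> : free_bimodule K T G) x) a.

HB.lock Definition bimod_r (K : fieldType) (T G : choiceType)
    (x : free_bimodule K T G) (a : free_algebra K T) : free_bimodule K T G :=
  lin_ext (fun w => lin_ext (fun k =>
    << (k.1.1, k.1.2, mmul k.2 w) >> : free_bimodule K T G) x) a.

(* The bimodule morphism u alpha v |-> u g(alpha) v. *)
HB.lock Definition bimod_eval (K : fieldType) (T G : choiceType)
    (g : G -> free_algebra K T) (x : free_bimodule K T G) : free_algebra K T :=
  lin_ext (fun k => << k.1.1 >> * g k.1.2 * << k.2 >>) x.

Section FreeBimodule.
Context {K : fieldType} {T G : choiceType}.
Implicit Types (x y : free_bimodule K T G) (g : G -> free_algebra K T).

Local Notation mon := (monomial T).
Local Notation A0 := (free_algebra K T).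
Local Notation mon1 := (mon * G * mon)%type.

Lemma bimod_l0 x : bimod_l 0 x = 0.
Proof. by rewrite bimod_l.unlock lin_ext0. Qed.

Lemma bimod_lP a c d x : bimod_l (a *: c + d) x = a *: bimod_l c x + bimod_l d x.
Proof. by rewrite bimod_l.unlock lin_extP. Qed.

Lemma bimod_lU w x : bimod_l << w >> x =
  lin_ext (fun k => << (mmul w k.1.1, k.1.2, k.2) >> : free_bimodule K T G) x.
Proof. by rewrite bimod_l.unlock lin_extU. Qed.

Lemma bimod_r0 x : bimod_r x 0 = 0.
Proof. by rewrite bimod_r.unlock lin_ext0. Qed.

Lemma bimod_rP a c d x : bimod_r x (a *: c + d) = a *: bimod_r x c + bimod_r x d.
Proof. by rewrite bimod_r.unlock lin_extP. Qed.

Lemma bimod_rU w x : bimod_r x << w >> =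
  lin_ext (fun k => << (k.1.1, k.1.2, mmul k.2 w) >> : free_bimodule K T G) x.
Proof. by rewrite bimod_r.unlock lin_extU. Qed.

Lemma bimod_eval0 g : bimod_eval g 0 = 0.
Proof. by rewrite bimod_eval.unlock lin_ext0. Qed.

Lemma bimod_evalP g a x y :
  bimod_eval g (a *: x + y) = a *: bimod_eval g x + bimod_eval g y.
Proof. by rewrite bimod_eval.unlock lin_extP. Qed.

Lemma bimod_evalU g k : bimod_eval g << k >> = << k.1.1 >> * g k.1.2 * << k.2 >>.
Proof. by rewrite bimod_eval.unlock lin_extU. Qed.

Lemma bimod_lC (c : K) x : bimod_l c%:MP x = c *: x.
Proof.
have -> : (c%:MP : A0) = c *: (<< @mone mon >> : A0).
  by apply/malgP=> l; rewrite mcoeffZ !mcoeffU mulrnAr mulr1.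
rewrite -[X in bimod_l X x]addr0 bimod_lP bimod_l0 addr0 bimod_lU.
congr (_ *: _).
elim/(@malg_lin_ind K mon1): x => [|a k x IH]; first by rewrite lin_ext0.
by rewrite lin_extP IH lin_extU mul1m; case: k => [[u al] v].
Qed.

Lemma bimod_eval_l g c x : bimod_eval g (bimod_l c x) = c * bimod_eval g x.
Proof.
elim/(@malg_lin_ind K mon): c => [|a w c IHc].
  by rewrite bimod_l0 bimod_eval0 mul0r.
rewrite bimod_lP bimod_evalP mulrDl -scalerAl.
apply: congr_lin IHc.
rewrite bimod_lU.
elim/(@malg_lin_ind K mon1): x => [|b [[u al] v] x IH].
  by rewrite lin_ext0 bimod_eval0 mulr0.
rewrite lin_extP !bimod_evalP mulrDr -malg_scalerAr.
apply: congr_lin IH.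
rewrite lin_extU; apply: etrans (bimod_evalU _ _) _.
rewrite bimod_evalU /=.
by rewrite -malg_mulUU -!mulrA.
Qed.

Lemma bimod_eval_r g c x : bimod_eval g (bimod_r x c) = bimod_eval g x * c.
Proof.
elim/(@malg_lin_ind K mon): c => [|a w c IHc].
  by rewrite bimod_r0 bimod_eval0 mulr0.
rewrite bimod_rP bimod_evalP mulrDr.
rewrite -malg_scalerAr; apply: congr_lin IHc.
rewrite bimod_rU.
elim/(@malg_lin_ind K mon1): x => [|b [[u al] v] x IH].
  by rewrite lin_ext0 bimod_eval0 mul0r.
rewrite lin_extP !bimod_evalP mulrDl -scalerAl.
apply: congr_lin IH.
rewrite lin_extU; apply: etrans (bimod_evalU _ _) _.
rewrite bimod_evalU /=.
by rewrite -malg_mulUU !mulrA.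
Qed.

Lemma bimod_evalD g x y : bimod_eval g (x + y) = bimod_eval g x + bimod_eval g y.
Proof. by rewrite -[x]scale1r bimod_evalP !scale1r. Qed.

Lemma bimod_evalB g x y : bimod_eval g (x - y) = bimod_eval g x - bimod_eval g y.
Proof. by rewrite addrC -scaleN1r bimod_evalP scaleN1r addrC. Qed.

Lemma bimod_eval_exch g x y a b c d :
  bimod_eval g (bimod_r x a + bimod_l b y - (bimod_l c y + bimod_r x d)) =
  bimod_eval g x * a + b * bimod_eval g y
    - (c * bimod_eval g y + bimod_eval g x * d).
Proof.
rewrite bimod_evalB (bimod_evalD g (bimod_r x a)) (bimod_evalD g (bimod_l c y)).
rewrite (bimod_eval_r g a) (bimod_eval_l g b) (bimod_eval_l g c).
by rewrite (bimod_eval_r g d).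
Qed.

End FreeBimodule.

Record polygraph (K : fieldType) := Polygraph {
  gen0 : choiceType;
  gen1 : choiceType;
  bsrc : gen1 -> free_algebra K gen0;
  btgt : gen1 -> free_algebra K gen0 }.

Arguments bsrc {K} X _ : rename.
Arguments btgt {K} X _ : rename.

Section Polygraph.
Context {K : fieldType} (X : polygraph K).

Local Notation mon := (monomial (gen0 X)).
Local Notation A0 := (free_algebra K (gen0 X)).

Definition left_monomial : Prop :=
  forall alpha, exists2 m : mon, bsrc X alpha = << m >>
    & m \notin msupp (btgt X alpha).

Inductive ideal : A0 -> Prop :=
| ideal_bound alpha : ideal (bsrc X alpha - btgt X alpha)
| ideal0 : ideal 0
| idealD a b : ideal a -> ideal b -> ideal (a + b)
| idealMl c a : ideal a -> ideal (c * a)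
| idealMr c a : ideal a -> ideal (a * c).

Definition idealp : {pred A0} := [pred a | `[< ideal a >]].

Lemma idealpP a : reflect (ideal a) (a \in idealp).
Proof. exact: asboolP. Qed.

Lemma idealp_submod_closed : submod_closed idealp.
Proof.
split=> [|c a b /idealpP Ia /idealpP Ib]; apply/idealpP; first exact: ideal0.
by apply: idealD Ib; rewrite -mul_malgC; apply: idealMl.
Qed.

HB.instance Definition _ :=
  GRing.isSubmodClosed.Build K A0 idealp idealp_submod_closed.

Definition presented_space : lmodType K := lquot idealp.

Definition presented_one : presented_space := lpi idealp 1.

Definition presented_mul (x y : presented_space) : presented_space :=
  lpi idealp (lrepr x * lrepr y).

Lemma presented_mulE a b :
  presented_mul (lpi idealp a) (lpi idealp b)
  = lpi idealp (a * b).
Proof.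
apply/lpiP/idealpP; set a' := lrepr _; set b' := lrepr _.
have Ia : ideal (a' - a) by apply/idealpP/lpiP; rewrite lreprK.
have Ib : ideal (b' - b) by apply/idealpP/lpiP; rewrite lreprK.
have -> : a' * b' - a * b = (a' - a) * b' + a * (b' - b).
  by rewrite mulrBl mulrBr addrA subrK.
by apply: idealD; [apply: idealMr | apply: idealMl].
Qed.

Lemma presented_is_algebra : is_algebra presented_one presented_mul.
Proof.
have P (Q : presented_space -> Prop) :
    (forall a, Q (lpi idealp a)) -> forall x, Q x.
  by move=> h x; rewrite -[x]lreprK.
split.
- by do 3![elim/P=> ?]; rewrite !presented_mulE mulrA.
- by elim/P=> x; rewrite presented_mulE mul1r.
- by elim/P=> x; rewrite presented_mulE mulr1.
- elim/P=> y c; do 2![elim/P=> ?].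
  by rewrite -linearP !presented_mulE -linearP mulrDl scalerAl.
- elim/P=> y c; do 2![elim/P=> ?].
  by rewrite -linearP !presented_mulE -linearP mulrDr malg_scalerAr.
Qed.

Definition presented : algebra K := Algebra presented_is_algebra.

Definition presented_proj (a : A0) : presented := lpi idealp a.

Local Notation bimod := (free_bimodule K (gen0 X) (gen1 X)).

Definition bimod_src : bimod -> A0 := bimod_eval (bsrc X).
Definition bimod_tgt : bimod -> A0 := bimod_eval (btgt X).

Definition precell : lmodType K := (bimod * A0)%type.

Definition exch_gen (a b : bimod) : precell :=
  (bimod_r a (bimod_src b) + bimod_l (bimod_tgt a) b,
   - (bimod_tgt a * bimod_src b))
  - (bimod_l (bimod_src a) b + bimod_r a (bimod_tgt b),
     - (bimod_src a * bimod_tgt b)).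

Inductive exch : precell -> Prop :=
| exch_rel a b : exch (exch_gen a b)
| exch0 : exch 0
| exchD f g : exch f -> exch g -> exch (f + g)
| exchMl c f : exch f -> exch (bimod_l c f.1, c * f.2)
| exchMr c f : exch f -> exch (bimod_r f.1 c, f.2 * c).

Definition exchp : {pred precell} := [pred f | `[< exch f >]].

Lemma exchpP f : reflect (exch f) (f \in exchp).
Proof. exact: asboolP. Qed.

Lemma exchp_submod_closed : submod_closed exchp.
Proof.
split=> [|c f g /exchpP Ef /exchpP Eg]; apply/exchpP; first exact: exch0.
apply: exchD Eg; move: (exchMl c%:MP Ef); rewrite bimod_lC mul_malgC.
by case: f {Ef}.
Qed.

HB.instance Definition _ :=
  GRing.isSubmodClosed.Build K precell exchp exchp_submod_closed.

(* The 1-cells of the free 1-algebra. *)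
Definition cell : lmodType K := lquot exchp.

Definition mk_cell (x : bimod) (c : A0) : cell := lpi exchp (x, c).

Definition src (f : cell) : A0 :=
  let p := lrepr f in bimod_src p.1 + p.2.
Definition tgt (f : cell) : A0 :=
  let p := lrepr f in bimod_tgt p.1 + p.2.

(* The choice of representatives in src and tgt is irrelevant. *)
Lemma exch_src_tgt f : exch f ->
  bimod_src f.1 + f.2 = 0 /\ bimod_tgt f.1 + f.2 = 0.
Proof.
elim=> [a b||{}f h _ [sf tf] _ [sh th]|c {}f _ [sf tf]|c {}f _ [sf tf]] /=.
- have zl (V : zmodType) (p q t : V) : p + q - (p + t) + (- q - - t) = 0.
    by rewrite opprK opprD [p + q + _]addrACA subrr add0r addrACA subrr addNr addr0.
  have zr (V : zmodType) (p q t : V) : q + p - (t + p) + (- q - - t) = 0.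
    by rewrite [q + p]addrC [t + p]addrC zl.
  split; apply: etrans (congr1 (+%R^~ _) (bimod_eval_exch _ _ _ _ _ _ _)) _.
    exact: zl.
  exact: zr.
- by split; apply: etrans (addr0 _) _; apply: bimod_eval0.
- by split; rewrite [LHS](congr1 (+%R^~ _) (bimod_evalD _ _ _)) addrACA
    ?[X in X + _]sf ?[X in X + _]tf add0r.
- by split; rewrite [LHS](congr1 (+%R^~ _) (bimod_eval_l _ _ _)) -mulrDr
    ?[X in _ * X]sf ?[X in _ * X]tf mulr0.
- by split; rewrite [LHS](congr1 (+%R^~ _) (bimod_eval_r _ _ _)) -mulrDl
    ?[X in X * _]sf ?[X in X * _]tf mul0r.
Qed.

Lemma src_mk x c : src (mk_cell x c) = bimod_src x + c.
Proof.
set p := lrepr (mk_cell x c).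
have /exchpP/exch_src_tgt [+ _] : p - (x, c) \in exchp by apply/lpiP; rewrite lreprK.
rewrite /src -/p /= /bimod_src bimod_evalB => e.
by apply/eqP; rewrite -subr_eq0 opprD addrACA e.
Qed.

Lemma tgt_mk x c : tgt (mk_cell x c) = bimod_tgt x + c.
Proof.
set p := lrepr (mk_cell x c).
have /exchpP/exch_src_tgt [_ +] : p - (x, c) \in exchp by apply/lpiP; rewrite lreprK.
rewrite /tgt -/p /= /bimod_tgt bimod_evalB => e.
by apply/eqP; rewrite -subr_eq0 opprD addrACA e.
Qed.

Definition idcell (a : A0) : cell := mk_cell 0 a.

Definition mon1cell (u : mon) (alpha : gen1 X) (v : mon) : cell :=
  mk_cell << (u, alpha, v) >> 0.

(* The composite of f : a -> b and g : b -> c, meaningful for tgt f = src g. *)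
Definition comp (f g : cell) : cell := f - idcell (tgt f) + g.

(* m is the source of the 1-monomial, which is a monomial when X is
   left-monomial. *)
Definition rewriting_step (h : cell) : Prop :=
  exists (lambda : K) (u : mon) (alpha : gen1 X) (v : mon) (a : A0) (m : mon),
  [/\ lambda != 0, src (mon1cell u alpha v) = << m >>, m \notin msupp a
    & h = lambda *: mon1cell u alpha v + idcell a].

Inductive positive : cell -> Prop :=
| positive_id a : positive (idcell a)
| positive_comp f g : rewriting_step f -> positive g -> tgt f = src g ->
    positive (comp f g).

Definition reduced (a : A0) : Prop :=
  ~ exists2 h, rewriting_step h & src h = a.

Definition reduced_monomial (m : mon) : Prop := reduced << m >>.

Definition normal_form (a b : A0) : Prop :=
  reduced b /\ exists f, [/\ positive f, src f = a & tgt f = b].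

Inductive succ_mon : mon -> mon -> Prop :=
| succ_gen alpha m v : bsrc X alpha = << m >> -> v \in msupp (btgt X alpha) ->
    succ_mon m v
| succ_ctx u u' v w : succ_mon u u' ->
    succ_mon (mmul (mmul v u) w) (mmul (mmul v u') w)
| succ_trans u v w : succ_mon u v -> succ_mon v w -> succ_mon u w.

Definition terminating : Prop := well_founded (fun v u => succ_mon u v).

Definition confluent : Prop :=
  forall f g, positive f -> positive g -> src f = src g ->
  exists h k, [/\ positive h, positive k, src h = tgt f, src k = tgt g
                & tgt h = tgt k].

Definition convergent : Prop := terminating /\ confluent.

Lemma reducedP a : reduced a <->
  forall u alpha v (m : mon), << u >> * bsrc X alpha * << v >> = << m >> -> a@_m = 0.
Proof.
have src1 u alpha v : src (mon1cell u alpha v) = << u >> * bsrc X alpha * << v >>.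
  by rewrite src_mk addr0 /bimod_src bimod_evalU.
have srcl l u alpha v (b : A0) : src (l *: mon1cell u alpha v + idcell b) =
    l *: (<< u >> * bsrc X alpha * << v >>) + b.
  rewrite /mon1cell /idcell /mk_cell -linearP src_mk /=.
  by rewrite /bimod_src bimod_evalP bimod_eval0 bimod_evalU addr0 scaler0 add0r.
split=> [ra u alpha v m e|h [_ [l [u [al [v [b [m [l0 e mb ->]]]]]]]]].
  apply/eqP/contraT=> am; case: ra.
  exists (a@_m *: mon1cell u alpha v + idcell (a - a@_m *: << m >>)).
    exists a@_m, u, alpha, v, (a - a@_m *: << m >>), m; split=> //.
      by rewrite src1.
    by rewrite -mcoeff_eq0 mcoeffB mcoeffZ mcoeffUU mulr1 subrr.
  by rewrite srcl e addrC subrK.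
rewrite src1 in e; rewrite srcl e => ea.
move: (h _ _ _ _ e); rewrite -ea mcoeffD mcoeffZ mcoeffUU mulr1.
by rewrite mcoeff_outdom // addr0; apply/eqP.
Qed.

Definition reducedp : {pred A0} := [pred a | `[< reduced a >]].

Lemma reducedp_submod_closed : submod_closed reducedp.
Proof.
split=> [|c a b /asboolP/reducedP ra /asboolP/reducedP rb].
  by apply/asboolP/reducedP=> *; rewrite mcoeff0.
apply/asboolP/reducedP=> u al v m e.
by rewrite mcoeffD mcoeffZ (ra _ _ _ _ e) (rb _ _ _ _ e) mulr0 addr0.
Qed.

HB.instance Definition _ :=
  GRing.isSubmodClosed.Build K A0 reducedp reducedp_submod_closed.

Record Red := MkRed { red_val :> A0; _ : red_val \in reducedp }.

HB.instance Definition _ := [isSub for red_val].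
HB.instance Definition _ := [Choice of Red by <:].
HB.instance Definition _ := [SubChoice_isSubLmodule of Red by <:].

(* Convergence ensures that every 0-cell has a unique normal form; the value 0
   is never used in that case. *)
Definition nf (a : A0) : Red :=
  if pselect (exists b : Red, normal_form a b) is left e then projT1 (cid e)
  else 0.

Definition red_mul (a b : Red) : Red := nf ((a : A0) * (b : A0)).

End Polygraph.

(* Main.v *)
Require Import Defs.
From mathcomp Require Import all_boot all_algebra.
From mathcomp Require Import boolp finmap.
From mathcomp.multinomials Require Import monalg.
Local Open Scope ring_scope.

Set Implicit Arguments.
Unset Strict Implicit.
Unset Printing Implicit Defensive.

Import GRing.Theory.

(** Each rewriting step of a left-monomial polygraph replaces a monomial by a
    combination of monomials inside a linear combination.  So rewriting of
    0-cells is an instance of linear rewriting in the free vector space on a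
    set, and most of the argument takes place there.

    Write a ~ b when a and b have a common reduct.  Confluence makes ~ an
    equivalence relation.  The main point is that ~ is a linear congruence
    (joinable_lin).  A single step does not survive the addition of a vector c:
    if c contains the rewritten monomial m, the total coefficient of m changes
    and may vanish.  But replacing m by its contractum with whatever
    coefficient it has, on both sides, leads to a common reduct, and
    transitivity of ~ extends this from steps to reductions.

    As ~ is a linear congruence and contains m ~ t for every rule m -> t,
    induction along the termination order shows that every monomial, hence by
    linearity every vector, is ~ to an irreducible one
    (joinable_irreducible_ex).  A vector that is ~ to an irreducible r rewrites
    to r, because r has no reduct but itself; so two irreducible vectors that
    are ~ are equal.

    For a polygraph, a ~ b holds exactly when a - b lies in the ideal I(X)
    (ideal_rewrites and joinable_proj): the vectors ~ to 0 form a subspace that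
    contains every u (s(alpha) - t(alpha)) v.  Hence every class modulo I(X)
    contains exactly one reduced 0-cell: the projection restricts to a linear
    bijection from Red(X) to the presented algebra.  Reduced 0-cells are the
    combinations of reduced monomials, which gives the basis.  Since a and its
    normal form have the same class, the bijection sends the product of Red(X)
    to that of the algebra, and being injective it carries the algebra laws
    back to Red(X) (is_algebra_inj). *)

(** * Linear identities *)

Lemma lin_subr (K : pzRingType) (V : lmodType K) (k : K) (x y c : V) :
  k *: x + c - (k *: y + c) = k *: (x - y).
Proof. by rewrite opprD addrACA subrr addr0 scalerBr. Qed.

Lemma lin_collect (K : pzRingType) (V : lmodType K) (k l mu : K) (x a c : V) :
  k *: (l *: x + a) + (mu *: x + c) = (k * l + mu) *: x + (k *: a + c).
Proof. by rewrite scalerDr scalerA addrACA -scalerDl. Qed.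

Lemma lin_exchange (K : pzRingType) (V : lmodType K) (k l mu : K) (x y a c : V) :
  k *: (l *: y + a) + (mu *: x + c) = mu *: x + (k *: (l *: y + a) + c).
Proof. by rewrite addrCA. Qed.

Lemma malg_expand (K : fieldType) (B : choiceType) (x : {malg K[B]}) :
  x = \sum_(k <- msupp x) x@_k *: << k >>.
Proof.
rewrite {1}[x]monalgE; apply: eq_bigr => k _.
by apply/malgP=> l; rewrite mcoeffZ !mcoeffU mulrnAr mulr1.
Qed.

Lemma malg_mul_linr (K : fieldType) (T : choiceType) k (x y z : free_algebra K T) :
  x * (k *: y + z) = k *: (x * y) + x * z.
Proof. by rewrite mulrDr malg_scalerAr. Qed.

Lemma malg_mul_linl (K : fieldType) (T : choiceType) k (x y z : free_algebra K T) :
  (k *: x + y) * z = k *: (x * z) + y * z.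
Proof. by rewrite mulrDl scalerAl. Qed.

Lemma mcoeff_lincomb (K : fieldType) (B : choiceType) (s : seq B) (c : B -> K) m :
  uniq s -> m \in s -> (\sum_(n <- s) c n *: << n >> : {malg K[B]})@_m = c m.
Proof.
move=> us ms; rewrite raddf_sum /= (bigD1_seq m) //= mcoeffZ mcoeffUU mulr1.
rewrite big1 ?addr0 // => n nm.
by rewrite mcoeffZ mcoeffU (negPf nm) mulr0.
Qed.

Lemma linear_fun0 (K : fieldType) (U V : lmodType K) (f : U -> V) :
  linear f -> f 0 = 0.
Proof. by move=> lf; have := lf (-1) 0 0; rewrite !scaleN1r oppr0 !addr0 addNr. Qed.

Lemma linear_fun_sum (K : fieldType) (U V : lmodType K) (f : U -> V) :
  linear f -> forall (I : Type) (s : seq I) (c : I -> K) (g : I -> U),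
  f (\sum_(i <- s) c i *: g i) = \sum_(i <- s) c i *: f (g i).
Proof.
move=> lf I s c g; elim: s => [|i s IH]; first by rewrite !big_nil linear_fun0.
by rewrite !big_cons lf IH.
Qed.

(** * Linear rewriting in a free vector space *)

Section LinearRewriting.
Context {K : fieldType} {B : choiceType}.
Local Notation V := {malg K[B]}.
Variable rule : B -> V -> Prop.
Implicit Types (k l : K) (m : B) (a b c d r t : V).

Inductive step : V -> V -> Prop :=
| Step l m t c : l != 0 -> rule m t -> m \notin msupp c ->
    step (l *: << m >> + c) (l *: t + c).

Inductive rewrites : V -> V -> Prop :=
| rewrites_refl a : rewrites a a
| rewrites_cons a b c : step a b -> rewrites b c -> rewrites a c.

Definition irreducible a := forall m t, rule m t -> a@_m = 0.

Definition joinable a b := exists2 c, rewrites a c & rewrites b c.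

Lemma rewrites_trans b a c : rewrites a b -> rewrites b c -> rewrites a c.
Proof. by elim=> // {}a d {}b s _ IH /IH; apply: rewrites_cons. Qed.

Lemma step_reducible a b : step a b -> ~ irreducible a.
Proof.
case=> l m t c l0 mt mc /(_ _ _ mt) /eqP.
by rewrite mcoeffD mcoeffZ mcoeffUU mulr1 (mcoeff_outdom mc) addr0 (negPf l0).
Qed.

Lemma rewrites_irreducible a b : rewrites a b -> irreducible a -> b = a.
Proof. by case=> // {}a d {}b /step_reducible. Qed.

Lemma joinable_refl a : joinable a a.
Proof. by exists a; apply: rewrites_refl. Qed.

Lemma joinable_sym a b : joinable a b -> joinable b a.
Proof. by case=> c; exists c. Qed.

Lemma joinable_irreducible a b : joinable a b -> irreducible b -> rewrites a b.
Proof. by case=> c ac /rewrites_irreducible bc /bc <-. Qed.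

Lemma irreducible_lin k a b :
  irreducible a -> irreducible b -> irreducible (k *: a + b).
Proof.
by move=> ra rb m t h; rewrite mcoeffD mcoeffZ (ra _ _ h) (rb _ _ h) mulr0 addr0.
Qed.

Lemma irreducible0 : irreducible 0.
Proof. by move=> m t _; apply: mcoeff0. Qed.

Lemma irreducible_msupp a m : irreducible a -> m \in msupp a ->
  irreducible << m >>.
Proof.
move=> ra ma n t h; rewrite mcoeffU; case: eqP => // mn; move: ma.
by rewrite -mcoeff_neq0 mn (ra _ _ h) eqxx.
Qed.

Section Convergent.
Variable gt : B -> B -> Prop.
Hypothesis gt_wf : well_founded (fun v u => gt u v).
Hypothesis rule_gt : forall m t v, rule m t -> v \in msupp t -> gt m v.
Hypothesis confl : forall a b c, rewrites a b -> rewrites a c -> joinable b c.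

(** Otherwise m would be a strict predecessor of itself in a well-founded
    order. *)
Lemma rule_notin m t : rule m t -> t@_m = 0.
Proof.
move=> h; have [/(rule_gt h)|/mcoeff_outdom//] := boolP (m \in msupp t).
by elim/(well_founded_ind gt_wf): (m) => n IH nn; case: (IH n nn nn).
Qed.

(** Allowing the coefficient 0, where the reduction is empty, spares the case
    analysis on vanishing coefficients when steps are added up. *)
Lemma rewrites_rule k m t c :
  rule m t -> c@_m = 0 -> rewrites (k *: << m >> + c) (k *: t + c).
Proof.
move=> h mc; have [->|k0] := eqVneq k 0; first by rewrite !scale0r; left.
by right with (k *: t + c); [apply: Step; rewrite // -mcoeff_eq0 mc | left].
Qed.

(** Confluence is applied at b, to its reducts shared with a and with c. *)
Lemma joinable_trans b a c : joinable a b -> joinable b c -> joinable a c.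
Proof.
case=> d ad bd [e be ce]; have [h dh eh] := confl bd be.
by exists h; [apply: rewrites_trans dh | apply: rewrites_trans eh].
Qed.

(** Adding c may change the coefficient of the rewritten m, even cancel it; but
    rewriting the remaining occurrences of m on both sides, with whatever
    coefficient they have, gives the same vector. *)
Lemma step_joinable_lin k a b c : step a b -> joinable (k *: a + c) (k *: b + c).
Proof.
case=> l m t {}a l0 h ma.
have [c' c'm ->] : exists2 c', c'@_m = 0 & c = c@_m *: << m >> + c'.
  exists (c - c@_m *: << m >>); last by rewrite addrC subrK.
  by rewrite mcoeffB mcoeffZ mcoeffUU mulr1 subrr.
move: (c@_m) => mu.
have am : a@_m = 0 := mcoeff_outdom ma.
have tm : t@_m = 0 by apply: rule_notin.
(* The left side has m with coefficient k * l + mu; on the right side only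
   the mu copies coming from c are left to rewrite. *)
exists ((k * l + mu) *: t + (k *: a + c')).
  rewrite lin_collect; apply: rewrites_rule => //.
  by rewrite mcoeffD mcoeffZ am c'm mulr0 addr0.
rewrite -lin_collect !lin_exchange; apply: rewrites_rule => //.
by rewrite !(mcoeffD, mcoeffZ) tm am c'm !(mulr0, addr0).
Qed.

Lemma joinable_linl k a b c : joinable a b -> joinable (k *: a + c) (k *: b + c).
Proof.
have H a' b' : rewrites a' b' -> joinable (k *: a' + c) (k *: b' + c).
  elim=> [{}a'|{}a' d {}b' s _]; first exact: joinable_refl.
  exact/joinable_trans/step_joinable_lin.
by case=> d /H ad /H bd; apply: joinable_trans ad (joinable_sym bd).
Qed.

Lemma joinable_lin k a b c d :
  joinable a b -> joinable c d -> joinable (k *: a + c) (k *: b + d).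
Proof.
move=> /(joinable_linl k c) ab /(joinable_linl 1 (k *: b)) cd.
by apply: joinable_trans ab _; move: cd; rewrite !scale1r ![_ + k *: b]addrC.
Qed.

Lemma joinable_rule m t : rule m t -> joinable << m >> t.
Proof.
move=> h; have := rewrites_rule 1 h (mcoeff0 m); rewrite !scale1r !addr0 => mt.
by exists t => //; left.
Qed.

Lemma joinable_irreducible_lin a :
    (forall m, m \in msupp a -> exists2 r, irreducible r & joinable << m >> r) ->
  exists2 r, irreducible r & joinable a r.
Proof.
move=> h; rewrite (malg_expand a).
have: {subset enum_fset (msupp a) <= msupp a} by [].
elim: (enum_fset (msupp a)) => [|m s IH] sa.
  exists 0; first exact: irreducible0.
  by rewrite big_nil; apply: joinable_refl.
have [r rr jr] := h m (sa m (mem_head m s)).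
have [|r' rr' jr'] := IH; first by move=> n ns; apply: sa; rewrite inE ns orbT.
exists (a@_m *: r + r'); first exact: irreducible_lin.
by rewrite big_cons; apply: joinable_lin.
Qed.

(** By linearity monomials suffice, and these are treated by induction along the
    termination order: a reducible m is joinable with its contractum t, whose
    monomials are smaller. *)
Lemma joinable_irreducible_ex a : exists2 r, irreducible r & joinable a r.
Proof.
apply: joinable_irreducible_lin => m _.
elim/(well_founded_ind gt_wf): m => m IH.
have [[t h]|nr] := pselect (exists t, rule m t).
  have [|r rr tr] := @joinable_irreducible_lin t.
    by move=> v /(rule_gt h) /IH.
  by exists r => //; apply: joinable_trans (joinable_rule h) tr.
exists << m >>; last exact: joinable_refl.
move=> n t h; rewrite mcoeffU; case: eqP => // mn.
by case: nr; exists t; rewrite mn.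
Qed.

End Convergent.
End LinearRewriting.

(** * One-cells and rewriting of 0-cells *)

Section Polygraph.
Context {K : fieldType} (X : polygraph K).

Local Notation mon := (monomial (gen0 X)).
Local Notation A0 := (free_algebra K (gen0 X)).
Implicit Types (a b c : A0) (m : mon).

Lemma mk_cell_repr (f : cell X) : f = mk_cell (lrepr f).1 (lrepr f).2.
Proof. by rewrite -[LHS]lreprK /mk_cell -surjective_pairing. Qed.

Lemma src_lin k (f g : cell X) : src (k *: f + g) = k *: src f + src g.
Proof.
rewrite [f]mk_cell_repr [g]mk_cell_repr.
move: (lrepr f).1 (lrepr f).2 (lrepr g).1 (lrepr g).2 => x c y d.
rewrite /mk_cell -linearP !src_mk /= /bimod_src bimod_evalP.
by rewrite scalerDr addrACA.
Qed.

Lemma tgt_lin k (f g : cell X) : tgt (k *: f + g) = k *: tgt f + tgt g.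
Proof.
rewrite [f]mk_cell_repr [g]mk_cell_repr.
move: (lrepr f).1 (lrepr f).2 (lrepr g).1 (lrepr g).2 => x c y d.
rewrite /mk_cell -linearP !tgt_mk /= /bimod_tgt bimod_evalP.
by rewrite scalerDr addrACA.
Qed.

Lemma src_idcell a : src (idcell a) = a.
Proof. by rewrite src_mk /bimod_src bimod_eval0 add0r. Qed.

Lemma tgt_idcell a : tgt (idcell a) = a.
Proof. by rewrite tgt_mk /bimod_tgt bimod_eval0 add0r. Qed.

Lemma src_mon1cell u alpha v :
  src (mon1cell u alpha v) = << u >> * bsrc X alpha * << v >>.
Proof. by rewrite src_mk addr0 /bimod_src bimod_evalU. Qed.

Lemma tgt_mon1cell u alpha v :
  tgt (mon1cell u alpha v) = << u >> * btgt X alpha * << v >>.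
Proof. by rewrite tgt_mk addr0 /bimod_tgt bimod_evalU. Qed.

Lemma comp_lin (f g : cell X) :
  Defs.comp f g = -1 *: idcell (tgt f) + (1 *: f + g).
Proof.
by rewrite /Defs.comp scale1r scaleN1r addrA [- _ + f]addrC.
Qed.

Lemma src_comp (f g : cell X) : tgt f = src g -> src (Defs.comp f g) = src f.
Proof.
move=> e; rewrite comp_lin !src_lin src_idcell e scale1r scaleN1r.
by rewrite [src f + _]addrC addKr.
Qed.

Lemma tgt_comp (f g : cell X) : tgt (Defs.comp f g) = tgt g.
Proof. by rewrite comp_lin !tgt_lin tgt_idcell scale1r scaleN1r addKr. Qed.

(** The rules of the associated linear rewriting system: all 1-monomials
    u alpha v, with the context absorbed in the rule. *)
Definition monomial_rule m (t : A0) := exists u alpha v,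
  << u >> * bsrc X alpha * << v >> = << m >> /\
  << u >> * btgt X alpha * << v >> = t.

Lemma rewriting_step_step (f : cell X) :
  rewriting_step f -> step monomial_rule (src f) (tgt f).
Proof.
case=> [l [u [al [v [c [m [l0 e mc ->]]]]]]].
rewrite src_lin tgt_lin src_idcell tgt_idcell e; apply: Step => //.
exists u, al, v; split; last exact/esym/tgt_mon1cell.
by apply: etrans e; apply/esym/src_mon1cell.
Qed.

Lemma step_rewriting_step a b : step monomial_rule a b ->
  exists f : cell X, [/\ rewriting_step f, src f = a & tgt f = b].
Proof.
case=> l m t c l0 [u [al [v [e <-]]]] mc.
exists (l *: mon1cell u al v + idcell c).
have e' : src (mon1cell u al v) = << m >> by apply: etrans (src_mon1cell _ _ _) e.
split; first by exists l, u, al, v, c, m.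
  by rewrite src_lin src_idcell e'.
by rewrite tgt_lin tgt_idcell tgt_mon1cell.
Qed.

(** Composition of 1-cells concatenates reductions; this turns confluence and
    normal forms into properties of 0-cells alone. *)
Lemma rewritesP a b : rewrites monomial_rule a b <->
  exists f : cell X, [/\ positive f, src f = a & tgt f = b].
Proof.
split.
  elim=> [{}a|{}a c {}b /step_rewriting_step [f [sf <- <-]] _ [g [pg sg <-]]].
    by exists (idcell a); rewrite src_idcell tgt_idcell; split=> //; left.
  have e : tgt f = src g by [].
  by exists (Defs.comp f g); rewrite src_comp // tgt_comp; split=> //; right.
case=> f [pf <- <-]; elim: {f} pf => [c|f g rf _ IH e].
  by rewrite src_idcell tgt_idcell; left.
rewrite src_comp // tgt_comp.
by right with (tgt f); [apply: rewriting_step_step | rewrite e].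
Qed.

Lemma reduced_irreducible a : reduced a <-> irreducible monomial_rule a.
Proof.
split=> [/reducedP ra m t [u [al [v [e _]]]]|ra]; first exact: ra e.
by apply/reducedP=> u al v m e; apply: (ra m); exists u, al, v.
Qed.

(** * The ideal as the class of 0 *)

Lemma ideal_step a b : step monomial_rule a b -> ideal (a - b).
Proof.
case=> l m _ c _ [u [al [v [<- <-]]]] _.
have := Defs.idealMr << v >> (idealMl << u >> (ideal_bound al)).
by rewrite mulrBr mulrBl => /(idealMl l%:MP); rewrite mul_malgC lin_subr.
Qed.

Lemma ideal_rewrites a b : rewrites monomial_rule a b -> ideal (a - b).
Proof.
elim=> {a b} [a|a b c /ideal_step Iab _ Ibc].
  by rewrite subrr; apply: ideal0.
by rewrite -(subrKA b); apply: idealD.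
Qed.

Lemma proj_rewrites a b :
  rewrites monomial_rule a b -> presented_proj a = presented_proj b.
Proof. by move=> /ideal_rewrites ab; apply/lpiP/idealpP. Qed.

Lemma mulUxU u v a :
  << u >> * a * << v >> =
  \sum_(k <- msupp a) a@_k *: << mmul (mmul u k) v >> :> A0.
Proof.
rewrite {1}(malg_expand a) mulr_sumr mulr_suml; apply: eq_bigr => k _.
by rewrite -malg_scalerAr -scalerAl !malg_mulUU.
Qed.

Section Convergent.
Hypotheses (hmon : left_monomial X) (hterm : terminating X) (hconf : confluent X).

Lemma malgU_inj (m n : mon) : << m >> = << n >> :> A0 -> m = n.
Proof.
move=> /(congr1 (mcoeff m)); rewrite !mcoeffU eqxx; case: eqP => // _ /eqP.
by rewrite oner_eq0.
Qed.

Lemma monomial_rule_ctx u alpha v :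
  exists2 m, << u >> * bsrc X alpha * << v >> = << m >> &
    monomial_rule m (<< u >> * btgt X alpha * << v >>).
Proof.
have [n en _] := hmon alpha; pose m := mmul (mmul u n) v.
have e : << u >> * bsrc X alpha * << v >> = << m >> by rewrite en !malg_mulUU.
by exists m => //; exists u, alpha, v.
Qed.

Lemma monomial_rule_succ m (t : A0) w :
  monomial_rule m t -> w \in msupp t -> succ_mon m w.
Proof.
case=> u [al [v [e <-]]]; have [n en _] := hmon al.
move: e; rewrite en !malg_mulUU => /malgU_inj <-.
rewrite -mcoeff_neq0 mulUxU raddf_sum /= => wt.
have [k kt <-] : exists2 k, k \in msupp (btgt X al) & mmul (mmul u k) v = w.
  apply: contrapT => nk; move: wt; rewrite big_seq big1 ?eqxx // => k kt.
  rewrite mcoeffZ mcoeffU; case: eqP => [kw|_]; last by rewrite mulr0.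
  by case: nk; exists k.
exact/succ_ctx/succ_gen/kt.
Qed.

Lemma monomial_rule_confl a b c :
  rewrites monomial_rule a b -> rewrites monomial_rule a c ->
  joinable monomial_rule b c.
Proof.
case/rewritesP=> f [pf sf <-] /rewritesP [g [pg sg <-]].
have [|h [k [ph pk sh sk hk]]] := hconf pf pg; first by rewrite sf.
by exists (tgt h); apply/rewritesP; [exists h | exists k].
Qed.

Let joinable_mon_lin := @joinable_lin K mon monomial_rule _
  hterm monomial_rule_succ monomial_rule_confl.

(** By linearity in b and c, contexts made of monomials suffice. *)
Lemma joinable_ctx0 a b c :
    (forall u v, joinable monomial_rule (<< u >> * a * << v >>) 0) ->
  joinable monomial_rule (b * a * c) 0.
Proof.
move=> ha.
have h0 k x y : joinable monomial_rule x 0 -> joinable monomial_rule y 0 ->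
    joinable monomial_rule (k *: x + y) 0.
  by move=> xj yj; have := joinable_mon_lin k xj yj; rewrite scaler0 addr0.
have hb u : joinable monomial_rule (<< u >> * a * c) 0.
  elim/(@malg_lin_ind K mon): c => [|k v c IH].
    by rewrite mulr0; apply: joinable_refl.
  by rewrite malg_mul_linr; apply: h0 (ha u v) IH.
elim/(@malg_lin_ind K mon): b => [|k u b IH].
  by rewrite !mul0r; apply: joinable_refl.
by rewrite malg_mul_linl malg_mul_linl; apply: h0 (hb u) IH.
Qed.

(** The monomial context u, v makes the induction over the ideal go through:
    boundaries are not closed under products, but in a monomial context they
    are differences between the two sides of a rule. *)
Lemma joinable_ideal0 a : ideal a ->
  forall u v, joinable monomial_rule (<< u >> * a * << v >>) 0.
Proof.
elim=> [al||{}a b _ IHa _ IHb|b {}a _ IH|b {}a _ IH] u v.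
- have [m e mt] := monomial_rule_ctx u al v.
  have := joinable_mon_lin 1 (joinable_rule mt)
    (joinable_refl _ (- (<< u >> * btgt X al * << v >>))).
  by rewrite !scale1r subrr mulrBr mulrBl -e.
- by rewrite mulr0 mul0r; apply: joinable_refl.
- by rewrite mulrDr mulrDl; have := joinable_mon_lin 1 (IHa u v) (IHb u v);
    rewrite !scale1r addr0.
- by rewrite mulrA; apply: joinable_ctx0.
- by rewrite mulrA -[_ * b * _]mulrA; apply: joinable_ctx0.
Qed.

(** The Church-Rosser property: congruence modulo the ideal is joinability. *)
Lemma joinable_proj a b :
  presented_proj a = presented_proj b -> joinable monomial_rule a b.
Proof.
move=> /lpiP /idealpP /joinable_ideal0 H.
have := @joinable_ctx0 _ 1 1 H; rewrite mul1r mulr1 => h.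
have := joinable_mon_lin 1 h (joinable_refl _ b).
by rewrite !scale1r subrK add0r.
Qed.

(** * Normal forms and the presented algebra *)

Lemma nf_proj a : presented_proj (nf a) = presented_proj a.
Proof.
rewrite /nf; case: pselect => [e|[]].
  by case: (cid e) => r /= [_ /rewritesP] /proj_rewrites.
have [r ir jr] :=
  @joinable_irreducible_ex K mon monomial_rule _
    hterm monomial_rule_succ monomial_rule_confl a.
have rr : r \in @reducedp K X by apply/asboolP/reduced_irreducible.
exists (MkRed rr); split; first exact/reduced_irreducible.
exact/rewritesP/joinable_irreducible.
Qed.

(** Joinable irreducible vectors coincide, since neither has another reduct. *)
Lemma red_proj_inj (r r' : Red X) :
  presented_proj r = presented_proj r' -> r = r'.
Proof.
case: r r' => [a ra] [b rb] /= /joinable_proj j; apply: val_inj => /=.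
have /reduced_irreducible ia := elimT (asboolP _) ra.
have /reduced_irreducible ib := elimT (asboolP _) rb.
exact/esym/(rewrites_irreducible _ ia)/joinable_irreducible.
Qed.

Lemma reduced_of_presented (p : presented X) :
  exists2 r, reduced r & presented_proj r = p.
Proof.
exists (nf (lrepr p)); last by rewrite nf_proj; apply: lreprK.
by case: (nf _) => r /= /asboolP.
Qed.

End Convergent.

Lemma presented_proj_lin : linear (@presented_proj K X).
Proof. by move=> k a b; rewrite /presented_proj linearP. Qed.

Lemma red_val_lin k (r r' : Red X) : red_val (k *: r + r') = k *: red_val r + red_val r'.
Proof. exact: (linearP (val : Red X -> A0)). Qed.

End Polygraph.

(** The laws of an algebra are identities, so they can be checked after an
    injective morphism. *)
Lemma is_algebra_inj (K : fieldType) (V : lmodType K) (one : V)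
    (mul : V -> V -> V) (A : algebra K) (f : V -> A) :
    linear f -> injective f -> f one = alg_one A ->
    {morph f : x y / mul x y >-> alg_mul x y} ->
  is_algebra one mul.
Proof.
move=> lf inj f1 fM; have [mA m1 m1r ml mr] := algP A.
split.
- by move=> x y z; apply: inj; rewrite !fM mA.
- by move=> x; apply: inj; rewrite fM f1 m1.
- by move=> x; apply: inj; rewrite fM f1 m1r.
- by move=> y k x x'; apply: inj; rewrite lf !fM lf ml.
- by move=> y k x x'; apply: inj; rewrite lf !fM lf mr.
Qed.

Lemma reduced_lincomb (K : fieldType) (X : polygraph K)
    (s : seq (monomial (gen0 X))) (c : monomial (gen0 X) -> K) :
    (forall m, m \in s -> reduced_monomial m) ->
  reduced (\sum_(m <- s) c m *: << m >>).
Proof.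
move=> rs; apply/reduced_irreducible; rewrite big_seq.
elim/big_ind: _ => [|a b|m /rs /reduced_irreducible].
- exact: irreducible0.
- by rewrite -{2}[a]scale1r; apply: irreducible_lin.
by rewrite -[c m *: _]addr0 => im; apply/irreducible_lin/irreducible0.
Qed.

Theorem theorem3p4p2 (K : fieldType) (A : algebra K) (X : polygraph K)
    (phi : presented X -> A) (hphi : algebra_iso phi)
    (hmon : left_monomial X) (hconv : convergent X) :
  linear_basis (@reduced_monomial K X)
    (fun m : monomial (gen0 X) => phi (presented_proj (<< m >> : free_algebra K (gen0 X)))) /\
  exists (one : Red X) (isalg : is_algebra one (@red_mul K X))
    (f : Algebra isalg -> A), algebra_iso f.
Proof.
have [lphi phi1 phiM [psi phiK psiK]] := hphi; have [hterm hconf] := hconv.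
pose h (a : free_algebra K (gen0 X)) := phi (presented_proj a).
have lh : linear h by move=> k a b; rewrite /h presented_proj_lin lphi.
have h_inj (r r' : Red X) : h r = h r' -> r = r'.
  by move=> /(can_inj phiK); apply: red_proj_inj.
split.
  split=> [s c us rs|v].
    rewrite -(linear_fun_sum lh s c) => h0 m ms.
    have /asboolP ra := @reduced_lincomb _ _ s c rs.
    have : MkRed ra = 0.
      by apply: h_inj; rewrite /= h0 [h _](linear_fun0 lh).
    move=> /(congr1 (fun r : Red X => (red_val r)@_m)) /=.
    by rewrite mcoeff_lincomb // => ->; apply: mcoeff0.
  have [r rr e] := reduced_of_presented hmon hterm hconf (psi v).
  exists (msupp r), (fun m => r@_m); split.
    move=> m mr; apply/reduced_irreducible; apply: irreducible_msupp mr.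
    exact/reduced_irreducible.
  by rewrite -(linear_fun_sum lh) -malg_expand /h e psiK.
pose f (r : Red X) := h r.
have lf : linear f by move=> k r r'; rewrite /f red_val_lin lh.
have hnf a : f (nf a) = h a by rewrite /f /h nf_proj.
have f1 : f (nf 1) = alg_one A by rewrite hnf.
have fM : {morph f : x y / red_mul x y >-> alg_mul x y}.
  by move=> x y; rewrite /red_mul hnf -phiM /= presented_mulE.
exists (nf 1), (is_algebra_inj lf h_inj f1 fM), f; split=> //.
have fK v : f (nf (lrepr (psi v))) = v.
  by rewrite hnf /h [presented_proj _]lreprK psiK.
by exists (fun v => nf (lrepr (psi v))) => // r; apply: h_inj; apply: fK.
Qed.
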